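(* Let $\varepsilon\in(0,1)$ and $\kappa>0$. In the experiment $Y\sim N(\mu,1)$, $\mu\in\mathbb R$, define $\phi_\kappa(Y)=\mathbf 1\{|Y|>\kappa\}$. Its worst-case sum-of-errors risk $$S_\varepsilon(\kappa):=\sup_{|\mu|\le(1-\varepsilon)\kappa}E_\mu\phi_\kappa(Y)+\sup_{|\mu|\ge(1+\varepsilon)\kappa}E_\mu\{1-\phi_\kappa(Y)\}$$ is $$S_\varepsilon(\kappa)=2\Phi(-\varepsilon\kappa)+\Phi\{-(2-\varepsilon)\kappa\}-\Phi\{-(2+\varepsilon)\kappa\}.$$ Moreover, $S_\varepsilon(\kappa)<1$ for every $\kappa>0$, and, as $\kappa\downarrow0$ with $\varepsilon$ fixed, $$S_\varepsilon(\kappa)=1-4\varepsilon\varphi(0)\kappa^3+O(\kappa^5).$$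
   Context: $\Phi$ and $\varphi$ are the standard normal distribution function and density; $E_\mu$ is expectation under $Y\sim N(\mu,1)$. *)

(* Defs.v *)
From HB Require Import structures.
From mathcomp Require Import all_boot all_order all_algebra.
From mathcomp Require Import all_classical all_reals all_analysis.

Set Implicit Arguments.
Unset Strict Implicit.
Unset Printing Implicit Defensive.

Import Order.TTheory GRing.Theory Num.Theory.
Import numFieldNormedType.Exports.

Local Open Scope classical_set_scope.
Local Open Scope ring_scope.

Definition std_normal_pdf (R : realType) (x : R) : R := normal_pdf 0 1 x.

Definition std_normal_cdf (R : realType) (x : R) : R :=
  fine (normal_prob 0 1 `]-oo, x]).

(* The second parameter of [normal_prob] is the standard deviation. *)
Definition normal_mean (R : realType) (mu : R) (f : R -> R) : \bar R :=
  ('E_(normal_prob mu 1)[f])%E.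

Definition cutoff_test (R : realType) (kappa : R) : R -> R :=
  \1_[set y | kappa < `|y|].

(* Each [ereal_sup] is over a nonempty set when 0 < eps < 1 and 0 < kappa. *)
Definition worst_risk (R : realType) (eps kappa : R) : \bar R :=
  (ereal_sup [set normal_mean mu (cutoff_test kappa) |
                mu in [set mu | (`|mu| <= (1 - eps) * kappa)%R]] +
   ereal_sup [set normal_mean mu (fun y => 1 - cutoff_test kappa y)%R |
                mu in [set mu | ((1 + eps) * kappa <= `|mu|)%R]])%E.

(* Main.v *)
(* By translation and symmetry of the normal law, the rejection probability
   under mu is Phi(mu - kappa) + Phi(-mu - kappa): it is even in mu, and
   nondecreasing on mu >= 0 because phi(mu - kappa) >= phi(mu + kappa), so both
   suprema are attained at the inner and outer boundary points. The bound
   S < 1 compares, by the mean value theorem, the mass of two intervals of equal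
   length 2 eps kappa, and the expansion comes from the fifth-order Taylor bound
   for Phi at 0: the linear terms cancel and the cubic ones add up to
   -4 eps phi(0) kappa^3. *)
Require Import Defs.
From HB Require Import structures.
From mathcomp Require Import all_boot all_order all_algebra.
From mathcomp Require Import all_classical all_reals all_analysis.
From mathcomp Require Import ring lra.
Import Order.TTheory GRing.Theory Num.Theory.
Import numFieldNormedType.Exports.
Local Open Scope classical_set_scope.
Local Open Scope ring_scope.

(** * The standard normal density *)

Lemma std_normal_pdfE {R : realType} (x : R) :
  std_normal_pdf x = std_normal_pdf 0 * expR (- (x ^+ 2 / 2)).
Proof.
rewrite /std_normal_pdf !normal_pdfE ?oner_neq0// /normal_fun !subr0 -mulrA.
rewrite -expRD.
by congr (_ * expR _); field.
Qed.

Lemma std_normal_pdf_gt0 {R : realType} (x : R) : 0 < std_normal_pdf x.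
Proof.
rewrite /std_normal_pdf normal_pdfE ?oner_neq0//.
by rewrite mulr_gt0 ?normal_peak_gt0 ?oner_neq0 ?expR_gt0.
Qed.

Lemma std_normal_pdfN {R : realType} (x : R) :
  std_normal_pdf (- x) = std_normal_pdf x.
Proof. by rewrite std_normal_pdfE sqrrN -std_normal_pdfE. Qed.

Lemma le_std_normal_pdf {R : realType} (x y : R) :
  `|x| <= `|y| -> std_normal_pdf y <= std_normal_pdf x.
Proof.
move=> xy; rewrite (std_normal_pdfE x) (std_normal_pdfE y).
rewrite ler_pM2l ?std_normal_pdf_gt0// ler_expR lerN2 ler_pM2r//.
by rewrite -real_normK ?num_real// -[leRHS]real_normK ?num_real// lerXn2r.
Qed.

Lemma lt_std_normal_pdf {R : realType} (x y : R) :
  `|x| < `|y| -> std_normal_pdf y < std_normal_pdf x.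
Proof.
move=> xy; rewrite (std_normal_pdfE x) (std_normal_pdfE y).
rewrite ltr_pM2l ?std_normal_pdf_gt0// ltr_expR ltrN2 ltr_pM2r//.
by rewrite -real_normK ?num_real// -[ltRHS]real_normK ?num_real// ltrXn2r.
Qed.

Lemma normal_pdf_center {R : realType} (m x : R) :
  normal_pdf m 1 (x + m) = std_normal_pdf x.
Proof.
by rewrite /std_normal_pdf !normal_pdfE ?oner_neq0// /normal_fun addrK subr0.
Qed.

(** * The distribution function: derivative, translation, reflection *)

Lemma is_derive_std_normal_cdf {R : realType} (x : R) :
  is_derive x 1 (@std_normal_cdf R) (std_normal_pdf x).
Proof.
(* The bound [x + 1] only places [x] in the interior of the domain, where the fundamental theorem of
   calculus applies. *)
have intf : lebesgue_measure.-integrable `]-oo, x + 1]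
    (EFin \o @std_normal_pdf R).
  by apply: integrableS (integrable_normal_pdf 0 1).
have xx1 : x < x + 1 by rewrite ltrDl.
have [] := continuous_FTC1 xx1 intf (ltNyr _).
  exact: continuous_normal_pdf.
by move=> d1 d2; apply: DeriveDef; rewrite -?derive1E.
Qed.

(** Substitution along the translation by [m], which has derivative 1, recenters the density at
    0. *)
Lemma normal_prob_itvNyc {R : realType} (m x : R) :
  normal_prob m 1 `]-oo, x] = (std_normal_cdf (x - m))%:E.
Proof.
rewrite fineK ?fin_num_measure// /normal_prob.
have F1 : derive1 (fun y : R => y + m) = cst 1.
  by apply/funext => y; rewrite derive1E derive_val addr0.
rewrite -[x in LHS](subrK m).
rewrite (@increasing_ge0_integration_by_substitutionNy _ (fun y => y + m)) ?F1.
- by apply: eq_integral => y _; rewrite fctE mulr1/= normal_pdf_center.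
- by move=> y z _ _; rewrite ltrD2r.
- by move=> y _; exact: cst_continuous.
- exact: is_cvg_cst.
- exact: cvg_cst.
- split=> [y _|]; first exact: ex_derive.
  by apply: cvg_at_left_filter; apply: cvgD; [exact: cvg_id|exact: cvg_cst].
- exact: cvg_addrr_Ny.
- by apply: continuous_subspaceT; exact: continuous_normal_pdf.
- by move=> y _; exact: normal_pdf_ge0.
Qed.

Lemma normal_prob_itvoy {R : realType} (m x : R) :
  normal_prob m 1 `]x, +oo[ = (1 - std_normal_cdf (x - m))%:E.
Proof.
by rewrite -setCitvl probability_setC//= normal_prob_itvNyc.
Qed.

Lemma normal_prob_set1 {R : realType} (m x : R) :
  normal_prob m 1 [set x] = 0%E.
Proof.
have /null_content_dominatesP := @normal_prob_dominates R m 1.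
by apply=> //; exact: lebesgue_measure_set1.
Qed.

Lemma normal_prob_itvNyo {R : realType} (m x : R) :
  normal_prob m 1 `]-oo, x[ = (std_normal_cdf (x - m))%:E.
Proof.
rewrite -normal_prob_itvNyc -(@setUitv1 _ _ _ _ true)// measureU//=.
  by rewrite normal_prob_set1 adde0.
by apply/seteqP; split=> y//= []/= + yx; rewrite yx in_itv/= ltxx.
Qed.

(** Substituting [- y] for [y] and using evenness of the density turns the lower tail at [- x] into
    the upper tail from [x]. Its complement is an open half-line, whose mass is the same as that of
    the closed one. *)
Lemma std_normal_cdfN {R : realType} (x : R) :
  std_normal_cdf (- x) = 1 - std_normal_cdf x.
Proof.
have := normal_prob_itvNyc 0 (- x).
rewrite subr0 /normal_prob ge0_integration_by_substitutionNy.
- under eq_integral do rewrite /= -/(std_normal_pdf _) std_normal_pdfN.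
  rewrite -setCitvl -[LHS]/(normal_prob 0 1 _) probability_setC//=.
  by rewrite normal_prob_itvNyo subr0 => -[].
- by apply: continuous_subspaceT; exact: continuous_normal_pdf.
- by move=> y _; exact: normal_pdf_ge0.
Qed.

(** * Error probabilities of the cutoff test *)

(* Rejection probability of the test with cutoff k at mean m. *)
Definition cutoff_power {R : realType} (k m : R) : R :=
  std_normal_cdf (m - k) + std_normal_cdf (- m - k).

Lemma set_gt_norm {R : realType} (k : R) :
  [set y | k < `|y|] = `]-oo, - k[ `|` `]k, +oo[.
Proof.
apply/seteqP; split=> y /=; rewrite !in_itv/= andbT.
  by rewrite real_ltr_normr ?num_real// => /orP[->|]; [right|left; lra].
by rewrite real_ltr_normr ?num_real// => -[yk|->//]; apply/orP; right; lra.
Qed.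

Lemma measurable_gt_norm {R : realType} (k : R) :
  measurable [set y : R | k < `|y|].
Proof. by rewrite set_gt_norm; exact: measurableU. Qed.

(** Positivity of [k] makes the two tails disjoint, so their masses add. *)
Lemma normal_prob_gt_norm {R : realType} (k m : R) : 0 < k ->
  normal_prob m 1 [set y | k < `|y|] = (cutoff_power k m)%:E.
Proof.
move=> k0; rewrite set_gt_norm measureU//=.
  rewrite normal_prob_itvNyo normal_prob_itvoy -std_normal_cdfN opprB addeC.
  by rewrite (addrC (- k)).
by apply/seteqP; split=> y//= []; rewrite /= !in_itv/= andbT; lra.
Qed.

Lemma normal_mean_cutoff_test {R : realType} (k m : R) : 0 < k ->
  normal_mean m (cutoff_test k) = (cutoff_power k m)%:E.
Proof.
move=> k0; rewrite /normal_mean /cutoff_test expectation_indic//.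
  exact: normal_prob_gt_norm.
exact: measurable_gt_norm.
Qed.

Lemma normal_mean_onem_cutoff_test {R : realType} (k m : R) : 0 < k ->
  normal_mean m (fun y => 1 - cutoff_test k y) = (1 - cutoff_power k m)%:E.
Proof.
move=> k0; rewrite /normal_mean /cutoff_test.
rewrite [X in expectation _ X](_ : _ = \1_(~` [set y | k < `|y|])).
  have mk := measurable_gt_norm k.
  rewrite expectation_indic ?probability_setC//; last exact: measurableC.
  by rewrite /= normal_prob_gt_norm.
by apply/funext => y; rewrite !indicE in_setC; case: (_ \in _);
  rewrite ?subrr ?subr0.
Qed.

Lemma cutoff_powerN {R : realType} (k m : R) :
  cutoff_power k (- m) = cutoff_power k m.
Proof. by rewrite /cutoff_power opprK addrC. Qed.

Lemma is_derive_std_normal_cdf_affine {R : realType} (a b x : R) :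
  is_derive x 1 (fun y : R => std_normal_cdf (a * y + b))
    (a * std_normal_pdf (a * x + b)).
Proof.
rewrite mulrC; apply: (@is_derive1_comp _ _ (fun y : R => a * y + b)).
  exact: is_derive_std_normal_cdf.
by apply: is_derive_eq; rewrite addr0 /GRing.scale/= mulr1.
Qed.

Lemma is_derive_cutoff_power {R : realType} (k m : R) :
  is_derive m 1 (cutoff_power k)
    (std_normal_pdf (m - k) - std_normal_pdf (m + k)).
Proof.
have -> : cutoff_power k =
    (fun y => std_normal_cdf (1 * y + - k)) \+
    (fun y => std_normal_cdf (-1 * y + - k)).
  by apply/funext => y; rewrite /cutoff_power/= mul1r mulN1r.
apply: is_derive_eq.
  by apply: is_deriveD; exact: is_derive_std_normal_cdf_affine.
by rewrite !mulN1r !mul1r -opprD std_normal_pdfN.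
Qed.

Lemma cutoff_power_nondecreasing {R : realType} (k m n : R) :
  0 < k -> 0 <= m -> m <= n -> cutoff_power k m <= cutoff_power k n.
Proof.
move=> k0; apply: (@ger0_derive1_ndecry _ (cutoff_power k)) => [x _|x|].
- by have [] := is_derive_cutoff_power k x.
- rewrite in_itv/= andbT => x0.
  rewrite derive1E (@derive_val _ _ _ _ _ _ _ (is_derive_cutoff_power k x)).
  (* For [x] and [k] nonnegative, [x - k] is no farther from 0 than [x + k]. *)
  rewrite subr_ge0; apply: le_std_normal_pdf.
  by rewrite (ger0_norm (_ : 0 <= x + k)) ?ler_norml; lra.
- apply: derivable_within_continuous => x _.
  by have [] := is_derive_cutoff_power k x.
Qed.

(** Evenness reduces this to nonnegative means; the form matches the constraints on the norm of the
    mean in both suprema. *)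
Lemma cutoff_power_le_norm {R : realType} (k m n : R) :
  0 < k -> `|m| <= `|n| -> cutoff_power k m <= cutoff_power k n.
Proof.
move=> k0 mn; have pnorm x : cutoff_power k x = cutoff_power k `|x|.
  by case: (ger0P x) => //; rewrite cutoff_powerN.
by rewrite pnorm (pnorm n); exact: cutoff_power_nondecreasing.
Qed.

(** * Closed form of the risk and strict bound by 1 *)

Lemma worst_riskE {R : realType} (eps k : R) :
  0 < eps -> eps < 1 -> 0 < k ->
  worst_risk eps k =
    (2 * std_normal_cdf (- (eps * k)) + std_normal_cdf (- ((2 - eps) * k))
     - std_normal_cdf (- ((2 + eps) * k)))%:E.
Proof.
move=> e0 e1 k0; set a := (1 - eps) * k; set b := (1 + eps) * k.
have a0 : 0 <= a by rewrite mulr_ge0 ?ltW// subr_gt0.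
have b0 : 0 <= b by rewrite mulr_ge0 ?ltW// addr_gt0.
(* For each supremum, the boundary value is shown first to be an upper bound, then to be
   attained. *)
have -> : worst_risk eps k = (cutoff_power k a)%:E + (1 - cutoff_power k b)%:E.
  rewrite /worst_risk -/a -/b; congr (_ + _)%E;
    apply/eqP; rewrite eq_le; apply/andP; split.
  - apply/ereal_supP => _ [m /= ma <-].
    rewrite normal_mean_cutoff_test// lee_fin cutoff_power_le_norm//.
    by rewrite (ger0_norm a0).
  - apply: ereal_sup_ubound; exists a; first by rewrite /= ger0_norm.
    exact: normal_mean_cutoff_test.
  - apply/ereal_supP => _ [m /= ma <-].
    rewrite normal_mean_onem_cutoff_test// lee_fin lerD2l lerN2.
    rewrite cutoff_power_le_norm//.
    by rewrite (ger0_norm b0).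
  - apply: ereal_sup_ubound; exists b; first by rewrite /= ger0_norm.
    exact: normal_mean_onem_cutoff_test.
rewrite -EFinD; congr EFin; rewrite /cutoff_power.
have -> : a - k = - (eps * k) by rewrite /a; ring.
have -> : - a - k = - ((2 - eps) * k) by rewrite /a; ring.
have -> : b - k = eps * k by rewrite /b; ring.
have -> : - b - k = - ((2 + eps) * k) by rewrite /b; ring.
(* Reflection turns 1 - Phi(eps k) into a second Phi(-eps k), whence the coefficient 2. *)
have := std_normal_cdfN (eps * k); lra.
Qed.

Lemma std_normal_cdf_MVT {R : realType} (x y : R) : x < y ->
  exists2 c, c \in `]x, y[ &
    std_normal_cdf y - std_normal_cdf x = std_normal_pdf c * (y - x).
Proof.
move=> xy; apply: MVT => // [z _|]; first exact: is_derive_std_normal_cdf.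
apply: derivable_within_continuous => z _.
by have [] := is_derive_std_normal_cdf z.
Qed.

(* The intervals ]-(2+eps)k, -(2-eps)k[ and ]-eps k, eps k[ have the same
   length, and the second is closer to the mode. *)
Lemma worst_risk_lt1 {R : realType} (eps k : R) :
  0 < eps -> eps < 1 -> 0 < k -> (worst_risk eps k < 1)%E.
Proof.
move=> e0 e1 k0; rewrite worst_riskE// lte_fin.
have ek0 : 0 < eps * k by rewrite mulr_gt0.
have ekk : eps * k < k by rewrite gtr_pMl.
have [|c] := @std_normal_cdf_MVT _ (- (eps * k)) (eps * k); first lra.
have [|d] := @std_normal_cdf_MVT _ (- ((2 + eps) * k)) (- ((2 - eps) * k)).
  by lra.
rewrite !in_itv/= => /andP[_ dk] dE /andP[ck kc] cE.
have cd : std_normal_pdf d < std_normal_pdf c.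
  apply: lt_std_normal_pdf; rewrite (ltr0_norm (_ : d < 0)); last by lra.
  by rewrite ltr_norml; apply/andP; split; lra.
have := ltr_pM2r (_ : 0 < 2 * (eps * k)) (std_normal_pdf d) (std_normal_pdf c).
rewrite cd => /(_ ltac:(lra)) cdk.
(* Replacing the density at [d] by the larger one at [c] bounds the risk strictly by Phi(-eps k) +
   Phi(eps k), which is 1. *)
have := std_normal_cdfN (eps * k).
nra.
Qed.

(** * Expansion at 0 *)

(** Both bounds come from exp(t) >= 1 + t: at t = -u for the lower one, and at t = u for the upper
    one, since (1 - u + u^2)(1 + u) = 1 + u^3 >= 1. *)
Lemma expRN_taylor {R : realType} (u : R) : 0 <= u ->
  1 - u <= expR (- u) <= 1 - u + u ^+ 2.
Proof.
move=> u0; apply/andP; split; first exact: expR_ge1Dx.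
rewrite expRN -[leLHS]mul1r ler_pdivrMr ?expR_gt0//.
apply: le_trans (_ : (1 - u + u ^+ 2) * (1 + u) <= _).
  have : 0 <= u ^+ 3 by rewrite exprn_ge0.
  by nra.
by rewrite ler_wpM2l ?expR_ge1Dx//; nra.
Qed.

Lemma std_normal_cdf0 {R : realType} : std_normal_cdf (0 : R) = 1 / 2.
Proof. by have := @std_normal_cdfN R 0; rewrite oppr0; lra. Qed.

Lemma is_derive_std_normal_cdf_sub_quintic {R : realType} (a b c x : R) :
  is_derive x 1
    (fun y => std_normal_cdf y - (a * y + b * y ^+ 3 + c * y ^+ 5))
    (std_normal_pdf x - (a + 3 * b * x ^+ 2 + 5 * c * x ^+ 4)).
Proof.
apply: is_deriveB; first exact: is_derive_std_normal_cdf.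
apply: is_derive_eq.
rewrite /GRing.scale/=; ring.
Qed.

(** The exponential bounds at u = y^2/2 enclose the density between polynomials, and monotonicity of
    differences integrates them from 0. The error term y^4/4 integrates to x^5/20. *)
Lemma std_normal_cdf_taylor {R : realType} (x : R) : 0 <= x ->
  `|std_normal_cdf x - 1 / 2 - std_normal_pdf 0 * (x - x ^+ 3 / 6)|
    <= std_normal_pdf 0 / 20 * x ^+ 5.
Proof.
move=> x0; set p : R := std_normal_pdf 0.
have p0 : 0 < p by exact: std_normal_pdf_gt0.
have pdfE y : p * (1 - y ^+ 2 / 2) <= std_normal_pdf y <=
    p * (1 - y ^+ 2 / 2 + y ^+ 4 / 4).
  have [|lb ub] := andP (@expRN_taylor _ (y ^+ 2 / 2) _).
    by rewrite divr_ge0 ?sqr_ge0.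
  rewrite std_normal_pdfE -/p !ler_pM2l// lb/=.
  by apply: le_trans ub _; rewrite lerD2l exprMn -exprM; lra.
(* [g 0] is nondecreasing and [g (p / 20)] nonincreasing on the nonnegative half-line, which gives
   the lower and the upper estimate. *)
pose g (c y : R) :=
  std_normal_cdf y - (p * y + - (p / 6) * y ^+ 3 + c * y ^+ 5).
have dg (c y : R) : is_derive y 1 (g c) _ :=
  is_derive_std_normal_cdf_sub_quintic p (- (p / 6)) c y.
have cg c : {within `[0, +oo[, continuous (g c)}.
  by apply: derivable_within_continuous => y _; have [] := dg c y.
have g0 c : g c 0 = 1 / 2.
  by rewrite /g std_normal_cdf0 !expr0n/= !mulr0 !addr0 subr0.
have lo : g 0 0 <= g 0 x.
  apply: (@ger0_derive1_ndecry _ (g 0) 0) => // y _.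
  rewrite derive1E (@derive_val _ _ _ _ _ _ _ (dg 0 y)).
  by have /andP[+ _] := pdfE y; lra.
have hi : g (p / 20) x <= g (p / 20) 0.
  apply: (@ler0_derive1_nincry _ (g (p / 20)) 0) => // y _.
  rewrite derive1E (@derive_val _ _ _ _ _ _ _ (dg (p / 20) y)).
  by have /andP[_] := pdfE y; lra.
move: lo hi; rewrite !g0 /g ler_norml; lra.
Qed.

Theorem proposition2 (R : realType) (eps : R) (heps0 : 0 < eps)
    (heps1 : eps < 1) :
  [/\ (forall kappa : R, 0 < kappa ->
         worst_risk eps kappa =
           (2 * std_normal_cdf (- (eps * kappa))
            + std_normal_cdf (- ((2 - eps) * kappa))
            - std_normal_cdf (- ((2 + eps) * kappa)))%:E),
      (forall kappa : R, 0 < kappa -> (worst_risk eps kappa < 1)%E) &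
      (fun kappa : R => fine (worst_risk eps kappa)) =
        (fun kappa : R => 1 - 4 * eps * std_normal_pdf 0 * kappa ^+ 3)
        +O_ (0^'+) (fun kappa : R => kappa ^+ 5)].
Proof.
split; [by move=> k; exact: worst_riskE|by move=> k; exact: worst_risk_lt1|].
apply/eqaddOP.
(* Sum of the three quintic remainders, weighted by the absolute coefficients 2, 1, 1 of the closed
   form. *)
pose C : R := std_normal_pdf 0 / 20 *
  (2 * eps ^+ 5 + (2 - eps) ^+ 5 + (2 + eps) ^+ 5).
near=> A; near=> k.
have k0 : 0 < k by near: k; exact: nbhs_right_gt.
have CA : C <= A by near: A; apply: nbhs_pinfty_ge; exact: num_real.
apply: le_trans (_ : C * `|k ^+ 5| <= _); last by rewrite ler_wpM2r.
rewrite !fctE worst_riskE//=.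
rewrite (ger0_norm (_ : 0 <= k ^+ 5)) ?exprn_ge0 ?(ltW k0)//.
have ek0 : 0 <= eps * k by rewrite mulr_ge0 ?ltW.
have mk0 : 0 <= (2 - eps) * k by rewrite mulr_ge0 ?ltW//; lra.
have pk0 : 0 <= (2 + eps) * k by rewrite mulr_ge0 ?ltW//; lra.
move: (std_normal_cdf_taylor _ ek0) (std_normal_cdf_taylor _ mk0)
  (std_normal_cdf_taylor _ pk0).
(* The linear coefficients -2 eps - (2 - eps) + (2 + eps) cancel; the cubic ones give (2 eps^3 + (2
   - eps)^3 - (2 + eps)^3) / 6 = -4 eps. *)
rewrite !std_normal_cdfN /C !ler_norml !exprMn.
move=> /andP[? ?] /andP[? ?] /andP[? ?]; apply/andP; split; lra.
Unshelve. all: by end_near. Qed.
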